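(* Let $r,c\in\mathbb{R}^n$ be vectors with nonnegative entries and $\lVert r\rVert_1=\lVert c\rVert_1=1$, let $C=[c_{ij}]_{i,j=1}^n\in\mathbb{R}^{n\times n}$ be a cost matrix, and let $\mathcal{F}$ be the set of optimal solutions of $\min_{P\ge 0:\, P\mathbf{1}=r,\, P^{\top}\mathbf{1}=c} C\cdot P$. Suppose that, for all $i,i',j,j'\in\{1,\dots,n\}$, one has $c_{ij}+c_{i'j'}=c_{i'j}+c_{ij'}$ if and only if $i=i'$ or $j=j'$. Then $$\tau(\mathcal{F})\le\frac{1+o(1)}{\sqrt{n}}.$$
   Context: $\mathbf{1}\in\mathbb{R}^n$ is the all-ones vector and $C\cdot P=\sum_{i,j}c_{ij}p_{ij}$. For an $n\times n$ matrix $M$, $\tau(M)=\lVert M\rVert_0/n^2$, where $\lVert M\rVert_0$ is the number of nonzero entries of $M$, and $\tau(\mathcal{F}):=\max_{M\in\mathcal{F}}\tau(M)$. Here $o(1)$ denotes a quantity depending only on $n$ that tends to $0$ as $n\to\infty$. *)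

(* Defs.v *)
From HB Require Import structures.
From mathcomp Require Import all_boot all_order all_algebra.
From mathcomp Require Import all_classical all_reals all_analysis.

Set Implicit Arguments.
Unset Strict Implicit.
Unset Printing Implicit Defensive.

Import Order.TTheory GRing.Theory Num.Theory.
Import numFieldNormedType.Exports.

Local Open Scope classical_set_scope.
Local Open Scope ring_scope.

(* The library norm on matrices is the sup norm, hence this definition. *)
Definition l1norm (R : realType) (n : nat) (v : 'cV[R]_n) : R :=
  \sum_(i < n) `|v i 0|.

Definition ones (R : realType) (n : nat) : 'cV[R]_n := const_mx 1.
Arguments ones {R n}.

Definition cost (R : realType) (n : nat) (C P : 'M[R]_n) : R :=
  \sum_(i < n) \sum_(j < n) C i j * P i j.

Definition feasible (R : realType) (n : nat) (r c : 'cV[R]_n) : set 'M[R]_n :=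
  [set P : 'M[R]_n | [/\ forall i j, 0 <= P i j, P *m ones = r & P^T *m ones = c]].

Definition optimal (R : realType) (n : nat) (r c : 'cV[R]_n) (C : 'M[R]_n) :
    set 'M[R]_n :=
  [set P : 'M[R]_n | feasible r c P /\
     forall Q, feasible r c Q -> cost C P <= cost C Q].

Definition l0norm (R : realType) (n : nat) (M : 'M[R]_n) : nat :=
  #|[set ij : 'I_n * 'I_n | M ij.1 ij.2 != 0]%SET|.

Definition tau (R : realType) (n : nat) (M : 'M[R]_n) : R :=
  (l0norm M)%:R / n%:R ^+ 2.

(* tau takes finitely many values on 'M[R]_n, so for nonempty F this supremum
   is a maximum: see tau_max_attained and tau_max_ub.  (sup set0 = 0.) *)
Definition tau_max (R : realType) (n : nat) (F : set 'M[R]_n) : R :=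
  sup [set tau M | M in F].

Lemma tau_max_spec (R : realType) (n : nat) (F : set 'M[R]_n) : F !=set0 ->
  exists2 M, F M & tau_max F = tau M /\ forall N, F N -> tau N <= tau M.
Proof.
move=> [M0 FM0].
have bnd k : `[< exists2 M, F M & l0norm M = k >] -> (k <= #|{: 'I_n * 'I_n}|)%N.
  by move=> /asboolP[M _ <-]; exact: max_card.
have ex : exists k, `[< exists2 M, F M & l0norm M = k >].
  by exists (l0norm M0); apply/asboolP; exists M0.
case: (ex_maxnP ex bnd) => k /asboolP[M FM Mk] kmax.
have Mmax N : F N -> tau N <= tau M.
  move=> FN; rewrite /tau ler_wpM2r ?invr_ge0 ?exprn_ge0 // ler_nat Mk.
  by apply: kmax; apply/asboolP; exists N.
exists M => //; split=> //; apply/eqP; rewrite eq_le; apply/andP; split.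
  by apply: ge_sup => [|_ [N FN <-]]; [exists (tau M), M | exact: Mmax].
by apply: ub_le_sup; [exists (tau M) => _ [N FN <-]; exact: Mmax | exists M].
Qed.

Lemma tau_max_attained (R : realType) (n : nat) (F : set 'M[R]_n) :
  F !=set0 -> exists2 M, F M & tau_max F = tau M.
Proof. by move=> /tau_max_spec[M FM [E _]]; exists M. Qed.

Lemma tau_max_ub (R : realType) (n : nat) (F : set 'M[R]_n) (M : 'M[R]_n) :
  F M -> tau M <= tau_max F.
Proof. by move=> FM; have [|N _ [-> ]] := @tau_max_spec R n F; [exists M | apply]. Qed.

(* Main.v *)
Require Import Defs.
From HB Require Import structures.
From mathcomp Require Import all_boot all_order all_algebra.
From mathcomp Require Import all_classical all_reals all_analysis.
From mathcomp Require Import ring lra.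

Set Implicit Arguments.
Unset Strict Implicit.
Unset Printing Implicit Defensive.

Import Order.TTheory GRing.Theory Num.Theory.
Import numFieldNormedType.Exports.

Local Open Scope classical_set_scope.
Local Open Scope ring_scope.

(** The support of an optimal plan contains no rectangle.  Indeed, if [P i j]
    and [P i' j'] are positive, then moving a small mass from the cells (i, j)
    and (i', j') to (i, j') and (i', j) keeps the marginals, so optimality
    gives [C i j + C i' j' <= C i j' + C i' j] ([optimal_swap]).  When all four
    corners are positive the same holds along the other diagonal, hence
    equality, which the hypothesis on [C] excludes for a nondegenerate
    rectangle.

    The support is thus a bipartite graph without 4-cycles, and the
    Kővári–Sós–Turán count ([C4free_card]) applies: each pair of distinct
    columns is met by at most one row, so the row degrees d_i satisfy
    [sum d_i ^ 2 <= m + n ^ 2] with [m = sum d_i], and Cauchy–Schwarz gives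
    [m ^ 2 <= n (m + n ^ 2)].  This forces [m / n <= sqrt n + 1], so that
    [eps n = 1 / sqrt n] is a valid error term. *)

(** * Optimal plans have a rectangle-free support *)

Section Exchange.
Variables (R : realType) (n : nat).
Implicit Types (C P D : 'M[R]_n) (r c : 'cV[R]_n).

Lemma costD C P D : cost C (P + D) = cost C P + cost C D.
Proof.
rewrite /cost -big_split; apply: eq_bigr => i _.
by rewrite -big_split; apply: eq_bigr => j _; rewrite mxE mulrDr.
Qed.

Lemma costZ C (t : R) D : cost C (t *: D) = t * cost C D.
Proof.
rewrite /cost mulr_sumr; apply: eq_bigr => i _.
by rewrite mulr_sumr; apply: eq_bigr => j _; rewrite mxE mulrCA.
Qed.

Lemma cost_delta C i j : cost C (delta_mx i j) = C i j.
Proof.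
rewrite /cost (bigD1 i) //= (bigD1 j) //= mxE !eqxx mulr1.
rewrite big1 => [|k kj]; last by rewrite mxE (negPf kj) andbF mulr0.
rewrite big1 ?addr0 // => k ki.
by rewrite big1 // => l _; rewrite mxE (negPf ki) mulr0.
Qed.

(** The direction that moves mass from the cells (i, j) and (i', j') to the
    cells (i, j') and (i', j). *)
Definition swap_mx (i i' j j' : 'I_n) : 'M[R]_n :=
  delta_mx i j' + delta_mx i' j + -1 *: (delta_mx i j + delta_mx i' j').

Lemma swap_mx_ones i i' j j' : swap_mx i i' j j' *m ones = 0.
Proof.
have E k l : delta_mx k l *m ones = delta_mx k 0 :> 'cV[R]_n.
  apply/colP => a; rewrite !mxE (bigD1 l) //= !mxE !eqxx mulr1 andbT.
  by rewrite big1 ?addr0 // => b bl; rewrite !mxE (negPf bl) andbF mul0r.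
by rewrite /swap_mx !mulmxDl -scalemxAl mulmxDl !E scaleN1r subrr.
Qed.

Lemma tr_swap_mx i i' j j' : (swap_mx i i' j j')^T = swap_mx j j' i i'.
Proof.
apply/matrixP => a b; rewrite !mxE.
by rewrite !(andbC (b == _)) [X in X + _ * _]addrC.
Qed.

Lemma optimal_swap r c C P i i' j j' : optimal r c C P ->
  0 < P i j -> 0 < P i' j' -> C i j + C i' j' <= C i j' + C i' j.
Proof.
move=> [[P0 Pr Pc] Popt] Pij Pij'.
have [->|ii'] := eqVneq i i'; first by rewrite addrC.
pose t := Num.min (P i j) (P i' j').
have t0 : 0 < t by rewrite lt_min Pij.
pose Q := P + t *: swap_mx i i' j j'.
have /Popt : feasible r c Q.
  split; last 2 first.
  - by rewrite mulmxDl -scalemxAl swap_mx_ones scaler0 addr0.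
  - by rewrite raddfD /= linearZ /= tr_swap_mx mulmxDl -scalemxAl swap_mx_ones
      scaler0 addr0.
  move=> k l; rewrite !mxE mulN1r mulrBr.
  have le_tP : t * ((k == i) && (l == j))%:R + t * ((k == i') && (l == j'))%:R
      <= P k l.
    (* the two source cells differ since [i != i'], so that a single cell
       loses at most [t] *)
    have [->|ki] := eqVneq k i.
      rewrite (negPf ii') mulr0 addr0 /=.
      by case: eqP => [->|_]; rewrite ?mulr0 // mulr1 ge_min lexx.
    rewrite mulr0 add0r; case: andP => [[/eqP-> /eqP->]|_]; last by rewrite mulr0.
    by rewrite mulr1 ge_min lexx orbT.
  rewrite [in X in _ - X]mulrDr addrCA addr_ge0 ?subr_ge0 //.
  by rewrite mulr_ge0 ?addr_ge0 // ltW.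
rewrite costD costZ lerDl pmulr_rge0 // /swap_mx !costD costZ costD !cost_delta.
by rewrite mulN1r subr_ge0.
Qed.

Lemma optimal_C4free r c C P i i' j j' :
    (forall i i' j j' : 'I_n,
       C i j + C i' j' = C i' j + C i j' <-> i = i' \/ j = j') ->
    optimal r c C P ->
    P i j != 0 -> P i j' != 0 -> P i' j != 0 -> P i' j' != 0 ->
  i = i' \/ j = j'.
Proof.
move=> Cgen optP Pij Pij' Pi'j Pi'j'; apply/Cgen.
have Pgt0 k l : P k l != 0 -> 0 < P k l.
  by case: optP => -[P0 _ _] _ Pkl; rewrite lt_neqAle eq_sym Pkl P0.
apply/le_anti; rewrite [C i' j + _]addrC (optimal_swap optP) ?Pgt0 //=.
by rewrite (optimal_swap optP) ?Pgt0.
Qed.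

End Exchange.

(** * Counting in rectangle-free relations *)

Lemma sqr_sum_le (R : realFieldType) (I : finType) (d : I -> R) :
  (\sum_i d i) ^+ 2 <= #|I|%:R * \sum_i d i ^+ 2.
Proof.
(* both sides are compared through [0 <= sum_(i, j) (d i - d j) ^ 2] *)
have : 0 <= \sum_i \sum_j (d i - d j) ^+ 2.
  by do 2!apply: sumr_ge0 => ? _; exact: sqr_ge0.
have -> : \sum_i \sum_j (d i - d j) ^+ 2 =
    (#|I|%:R * \sum_i d i ^+ 2 - (\sum_i d i) ^+ 2) *+ 2.
  transitivity (\sum_i (#|I|%:R * d i ^+ 2 - (d i * \sum_j d j) *+ 2
                        + \sum_j d j ^+ 2)).
    apply: eq_bigr => i _; under eq_bigr do rewrite sqrrB.
    by rewrite big_split sumrB sumr_const sumrMnl -mulr_sumr mulr_natl.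
  rewrite big_split sumrB sumr_const -mulr_sumr sumrMnl -mulr_suml /=.
  by rewrite -[_ *+ #|_|]mulr_natl; ring.
by rewrite pmulrn_lge0 // subr_ge0.
Qed.

(** The Kővári–Sós–Turán bound on the number of edges of a bipartite graph
    without 4-cycles, before solving the quadratic inequality. *)
Lemma C4free_card (R : realFieldType) (I J : finType) (S : I -> J -> bool)
    (m := (\sum_i \sum_j S i j)%N) :
    (forall i i' j j', S i j -> S i j' -> S i' j -> S i' j' ->
       i = i' \/ j = j') ->
  m%:R ^+ 2 <= #|I|%:R * (m%:R + #|J|%:R ^+ 2) :> R.
Proof.
move=> C4free; pose d i := (\sum_j S i j)%N.
have -> : m%:R = \sum_i (d i)%:R :> R by rewrite /m natr_sum.
apply: (le_trans (sqr_sum_le _)); rewrite ler_wpM2l ?ler0n //.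
under eq_bigr do rewrite -natrX.
rewrite -!natr_sum -natrX -natrD ler_nat.
(* double counting of the triples (i, j, k) with [S i j] and [S i k] *)
have -> : (\sum_i d i ^ 2 = \sum_j \sum_k \sum_i S i j * S i k)%N.
  transitivity (\sum_i \sum_j \sum_k S i j * S i k)%N.
    apply: eq_bigr => i _; rewrite -mulnn /d big_distrl.
    by apply: eq_bigr => j _; rewrite big_distrr.
  by rewrite exchange_big; apply: eq_bigr => j _; exact: exchange_big.
have codeg j k : (\sum_i S i j * S i k <= (j == k) * (\sum_i S i j) + 1)%N.
  have [<-|jk] := eqVneq j k.
    rewrite mul1n (leq_trans _ (leq_addr _ _)) // leq_sum // => i _.
    by case: (S i j).
  rewrite mul0n add0n; have [i /andP[Sij Sik]|no] := pickP (fun i => S i j && S i k).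
    rewrite (bigD1 i) //= Sij Sik big1 // => i' i'i.
    case Si'j: (S i' j); case Si'k: (S i' k) => //.
    have [ii'|/eqP] := C4free _ _ _ _ Sij Sik Si'j Si'k; last by rewrite (negPf jk).
    by rewrite ii' eqxx in i'i.
  by rewrite big1 // => i _; rewrite mulnb no.
apply: (@leq_trans (\sum_j \sum_k ((j == k) * (\sum_i S i j) + 1))%N).
  by do 2!apply: leq_sum => ? _; exact: codeg.
under eq_bigr do rewrite big_split sum1_card /=.
rewrite big_split sum_nat_const mulnn leq_add2r /d [leqRHS]exchange_big /=.
apply: leq_sum => j _.
rewrite (bigD1 j) //= eqxx mul1n [X in (_ + X)%N]big1 ?addn0 // => k kj.
by rewrite eq_sym (negPf kj).
Qed.

(** * The sparsity bound *)

Lemma l0normE (R : realType) (n : nat) (P : 'M[R]_n) :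
  l0norm P = (\sum_i \sum_j (P i j != 0%R))%N.
Proof.
rewrite /l0norm -sum1_card pair_big /= big_mkcond /=.
by apply: eq_bigr => -[i j] _; rewrite inE /=; case: eqP.
Qed.

Lemma tau_optimal_le (R : realType) (n : nat) (r c : 'cV[R]_n) (C P : 'M[R]_n) :
    (0 < n)%N ->
    (forall i i' j j' : 'I_n,
       C i j + C i' j' = C i' j + C i j' <-> i = i' \/ j = j') ->
    optimal r c C P ->
  tau P <= (1 + (Num.sqrt n%:R)^-1) / Num.sqrt n%:R.
Proof.
move=> n0 Cgen optP.
have := @C4free_card R _ _ (fun i j => P i j != 0)
  (fun i i' j j' => optimal_C4free Cgen optP).
rewrite -l0normE card_ord /tau.
set m : R := (l0norm P)%:R; set s := Num.sqrt n%:R.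
have s0 : 0 < s by rewrite sqrtr_gt0 ltr0n.
have -> : n%:R = s ^+ 2 :> R by rewrite sqr_sqrtr.
move=> quad; rewrite ler_pdivrMr ?exprn_gt0 //.
have -> : (1 + s^-1) / s * (s ^+ 2) ^+ 2 = s ^+ 2 * (s + 1).
  by field; rewrite gt_eqF.
(* with [x = m / n], [quad] reads [x * (x - 1) <= n], whereas [x > s + 1] would
   give [x * (x - 1) > n + s] *)
rewrite leNgt; apply/negP => big_m.
have m1 : s ^+ 2 * s < m - s ^+ 2 by lra.
have : s ^+ 2 * (s + 1) * (s ^+ 2 * s) < m * (m - s ^+ 2).
  by apply: ltr_pM => //; rewrite ?mulr_ge0 ?exprn_ge0 ?addr_ge0 // ltW.
have : 0 < s ^+ 5 by rewrite exprn_gt0.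
move: quad; lra.
Qed.

Lemma cvg_inv_sqrt_nat (R : realType) :
  (fun n => (Num.sqrt n%:R)^-1 : R) @ \oo --> (0 : R).
Proof.
apply/cvgr0Pnorm_lt => e e0; near=> n.
have n_gt : (e^-1) ^+ 2 < n%:R :> R by near: n; exact: nbhs_infty_gtr.
rewrite ger0_norm ?invr_ge0 ?sqrtr_ge0 // invf_plt ?posrE ?sqrtr_gt0 //; last first.
  exact: le_lt_trans (sqr_ge0 _) n_gt.
rewrite -[ltLHS]ger0_norm ?invr_ge0 ?(ltW e0) // -sqrtr_sqr ltr_sqrt //.
exact: le_lt_trans (sqr_ge0 _) n_gt.
Unshelve. all: by end_near. Qed.

Theorem theorem3 (R : realType) :
  exists eps : nat -> R,
    eps @ \oo --> (0 : R) /\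
    forall (n : nat) (r c : 'cV[R]_n) (C : 'M[R]_n),
      (forall i, 0 <= r i 0) -> (forall i, 0 <= c i 0) ->
      l1norm r = 1 -> l1norm c = 1 ->
      (forall i i' j j' : 'I_n,
         C i j + C i' j' = C i' j + C i j' <-> i = i' \/ j = j') ->
      tau_max (optimal r c C) <= (1 + eps n) / Num.sqrt n%:R.
Proof.
exists (fun n => (Num.sqrt n%:R)^-1); split; first exact: cvg_inv_sqrt_nat.
move=> n r c C _ _ r1 _ Cgen.
have n0 : (0 < n)%N.
  rewrite lt0n; apply/eqP => n0; subst n.
  by move: r1 => /eqP; rewrite /l1norm big_ord0 eq_sym oner_eq0.
have [->|/set0P/tau_max_attained[P optP ->]] := eqVneq (optimal r c C) set0.
  (* the supremum of the empty set is 0 *)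
  rewrite /tau_max image_set0 sup0.
  by rewrite divr_ge0 ?addr_ge0 ?invr_ge0 ?sqrtr_ge0.
exact: tau_optimal_le optP.
Qed.
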